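(* Property B is an invariant for conjugacy of flows: if $\{F_t\}_{t\in\mathbb{R}}$ and $\{F'_t\}_{t\in\mathbb{R}}$ are conjugate flows on standard $\sigma$-finite measure spaces $(X,\mathfrak{B},\mu)$ and $(X',\mathfrak{B}',\mu')$ respectively, and $\{F_t\}_{t\in\mathbb{R}}$ has Property B, then $\{F'_t\}_{t\in\mathbb{R}}$ has Property B.
   Context: A (measurable) flow on $(X,\mathfrak{B},\mu)$ is a one-parameter group $\{F_t\}_{t\in\mathbb{R}}$ of nonsingular automorphisms of $(X,\mathfrak{B},\mu)$ such that $X\times\mathbb{R}\ni(x,t)\mapsto F_t(x)\in X$ is measurable. Two flows $\{F_t\}$ on $(X,\mathfrak{B},\mu)$ and $\{F'_t\}$ on $(X',\mathfrak{B}',\mu')$ are conjugate if there exists an isomorphism $T:(X,\mathfrak{B},\mu)\to(X',\mathfrak{B}',\mu')$ (a measurable bijection modulo null sets, nonsingular in both directions, not necessarily measure preserving) such that for all $t\in\mathbb{R}$ and $\mu$-almost all $x\in X$, $F'_t(T(x))=T(F_t(x))$. Property B: for $A\in\mathfrak{B}$ of positive measure and $s,\delta>0$ let $\Lambda_{F,\delta,s}(A)=\{x\in A:\ \exists t\in(e^{s-\delta},e^{s+\delta})\cup(-e^{s+\delta},-e^{s-\delta}),\ F_t(x)\in A\}$. The flow $\{F_t\}$ on $(X,\mathfrak{B},\mu)$ has Property B if there exists a measurable set $A\subseteq X$ of positive measure such that for all $\delta>0$, $\limsup_{s\to\infty}\mu(\Lambda_{F,\delta,s}(A))=0$. *)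

(* Defs.v *)
From HB Require Import structures.
From mathcomp Require Import all_boot all_order all_algebra.
From mathcomp Require Import all_classical all_reals all_analysis.

Set Implicit Arguments.
Unset Strict Implicit.
Unset Printing Implicit Defensive.
Import Order.TTheory GRing.Theory Num.Theory.
Import numFieldNormedType.Exports.

Local Open Scope classical_set_scope.
Local Open Scope ring_scope.

(* Polish spaces are presented as complete separable pseudometric spaces that
   are Hausdorff, hence metric; <<s open >> is the Borel sigma-algebra.
   As f is bijective, the last clause makes f an isomorphism of measurable
   spaces. *)
Definition standard_borel (R : realType) (d : measure_display)
    (X : measurableType d) : Prop :=
  exists (P : completePseudoMetricType R) (f : X -> P),
    [/\ hausdorff_space P,
        (exists D : set P, countable D /\ dense D),
        bijective f
      & (measurable : set (set X)) =
          [set f @^-1` B | B in <<s (open : set (set P)) >>] ].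

Section nonsingular.
Variables (R : realType) (d d' : measure_display).
Variables (X : measurableType d) (X' : measurableType d').
Variables (mu : set X -> \bar R) (mu' : set X' -> \bar R).

Definition nonsingular_iso_on (X0 : set X) (X0' : set X') (T : X -> X') : Prop :=
  [/\ set_bij X0 X0' T,
      measurable_fun X0 T,
      (forall A, A `<=` X0 -> measurable A -> measurable (T @` A))
    & (forall A, A `<=` X0 -> measurable A ->
         mu A = 0%E <-> mu' (T @` A) = 0%E) ].

(* The isomorphism is only defined modulo null sets: the values of the total
   function T outside the conull set X0 are irrelevant. *)
Definition nonsingular_isomorphism (T : X -> X') : Prop :=
  exists (X0 : set X) (X0' : set X'),
    [/\ measurable X0 /\ mu (~` X0) = 0%E,
        measurable X0' /\ mu' (~` X0') = 0%E
      & nonsingular_iso_on X0 X0' T ].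

End nonsingular.

Definition nonsingular_automorphism (R : realType) (d : measure_display)
    (X : measurableType d) (mu : set X -> \bar R) (f : X -> X) : Prop :=
  nonsingular_iso_on mu mu setT setT f.

(* The group law holds at every point: the sets in Property B involve the
   whole orbit of a point, so a group law holding only almost everywhere for
   each pair of times would not be enough. *)
Definition flow (R : realType) (d : measure_display) (X : measurableType d)
    (mu : set X -> \bar R) (F : R -> X -> X) : Prop :=
  [/\ (forall t, nonsingular_automorphism mu (F t)),
      (forall x, F 0 x = x),
      (forall s t x, F (s + t) x = F s (F t x))
    & measurable_fun [set: X * R] (fun p : X * R => F p.2 p.1) ].

Definition conjugate_flows (R : realType) (d d' : measure_display)
    (X : measurableType d) (X' : measurableType d')
    (mu : {measure set X -> \bar R}) (mu' : {measure set X' -> \bar R})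
    (F : R -> X -> X) (F' : R -> X' -> X') : Prop :=
  exists T : X -> X', nonsingular_isomorphism mu mu' T /\
    forall t : R, {ae mu, forall x, F' t (T x) = T (F t x)}.

Definition return_set (R : realType) (X : Type) (F : R -> X -> X)
    (delta s : R) (A : set X) : set X :=
  [set x | A x /\ exists t : R,
     (`]expR (s - delta), expR (s + delta)[ `|`
      `]- expR (s + delta), - expR (s - delta)[) t /\ A (F t x)].

(* return_set is the projection of a measurable subset of X * R: on a standard
   Borel space it is analytic, hence measurable for the completion of mu, but
   possibly not measurable. Its measure is therefore taken with the outer
   measure mu^* induced by mu, which agrees with the completion of mu on
   completion-measurable sets. *)
Definition property_B (R : realType) (d : measure_display)
    (X : measurableType d) (mu : {measure set X -> \bar R})
    (F : R -> X -> X) : Prop :=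
  exists A : set X,
    [/\ measurable A,
        (0 < mu A)%E
      & forall delta : R, 0 < delta ->
          limf_esup (fun s : R => mu^*%mu (return_set F delta s A))
                    (pinfty_nbhs R) = 0%E ].

(* Main.v *)
Require Import Defs.
From HB Require Import structures.
From mathcomp Require Import all_boot all_order all_algebra.
From mathcomp Require Import all_classical all_reals all_analysis.
From mathcomp Require Import ring lra.

(** Let [A] witness Property B for [F], let [T] be the conjugacy, a bijection
between the conull sets [X0] and [X0'].  A positive-measure part [A'] of
[T @` A] is to be a witness for [F'].  There are two obstacles.

First, the equation [F' t (T x) = T (F t x)] holds off a null set that depends
on [t], whereas a return set sees the whole orbit of a point.  Call a pair
[(x, t)] bad if the equation fails there or [x] or [F t x] is outside [X0].
The set of bad pairs is measurable, because points of a standard Borel space are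
separated by countably many measurable sets, so equality of two measurable
functions is a measurable condition.  By Tonelli, almost every [x] is good: for
Lebesgue-almost every [t] the pair [(x, t)] is not bad.  Let [x], [y] be good
with [F' t (T x) = T y].  For almost every [u],
[T (F (u + t) x) = F' (u + t) (T x) = F' u (T y) = T (F u y)] with both
[F (u + t) x] and [F u y] in [X0], and one such [u] gives
[F (u + t) x = F u y], hence [F t x = y].  So a return of [F'] between images
of good points is a return of [F] at exactly the same time
([conull_orbit_conjugacy]).  Consequently, if [A'] consists of images of good
points of [A], its return sets are contained in the images of those of [A].

Second, [T] does not preserve the measure, so smallness of a set must be
transported.  If [A'] has finite measure, which can be arranged by
sigma-finiteness, then [mu' (T @` B `&` A')], for [B] inside [X0], is a finite
measure in [B], absolutely continuous with respect to [mu], and is therefore small as soon as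
[mu B] is ([nonsingular_iso_abs_continuous]).  Covering a return set of [A] by
a measurable set of almost the same outer measure finishes the proof. *)

Set Implicit Arguments.
Unset Strict Implicit.
Unset Printing Implicit Defensive.
Import Order.TTheory GRing.Theory Num.Theory.
Import numFieldNormedType.Exports.

Local Open Scope classical_set_scope.
Local Open Scope ring_scope.

(** * Measurability of the equality of two functions *)

Definition separates (I T : Type) (E : I -> set T) : Prop :=
  forall x y : T, x <> y -> exists i, E i x /\ ~ E i y.

(** The interiors of the balls of radius [1 / (k + 1)] around the points of a
countable dense set separate the points of a Hausdorff pseudometric space. *)
Lemma standard_borel_separates (R : realType) d (X : measurableType d) :
  standard_borel R X ->
  exists E : nat * nat -> set X, (forall i, measurable (E i)) /\ separates E.
Proof.
move=> [P [f [hP [D [cD dD]] bf mE]]].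
(* [g] numbers the dense set, so [B (n, k)] is the interior of the ball of
   radius [r k] around its [n]-th point, empty if there is no such point. *)
have [g gI] := countable_injP _ cD.
pose r (k : nat) : R := k.+1%:R^-1.
pose B (i : nat * nat) : set P :=
  \bigcup_(q in [set q | D q /\ g q = i.1]) (ball q (r i.2))°.
exists (fun i => f @^-1` B i); split.
  move=> i; rewrite mE; exists (B i) => //.
  apply: sub_sigma_algebra; apply: bigcup_open => q _; exact: open_interior.
move=> x y xy.
have fxy : f x != f y by apply/eqP => /(bij_inj bf).
move: hP; rewrite open_hausdorff => /(_ _ _ fxy) [[U V] /= [Ux Vy] [oU oV UV]].
have : nbhs (f x) U by apply: open_nbhs_nbhs; split => //; rewrite -inE.
move=> /nbhs_ballP [e /= e0 eU].
(* The ball of radius [r k] around a dense point [q] within [r k / 2] of [f x]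
   stays within [r k / 2 + r k < e] of [f x], so it misses [f y]. *)
have [k] : exists k : nat, 0 + r k < e / 2.
  by apply: ltr_add_invr; rewrite divr_gt0.
rewrite add0r => ke.
have r0 : 0 < r k by rewrite invr_gt0.
have [q [qx Dq]] : (ball (f x) (r k / 2))° `&` D !=set0.
  apply: dD; last exact: open_interior.
  by exists (f x); apply: nbhsx_ballx; rewrite divr_gt0.
have {}qx : ball (f x) (r k / 2) q by exact: interior_subset qx.
exists (g q, k); split => /=.
  exists q => //; apply/nbhs_ballP; exists (r k / 2); first by rewrite /= divr_gt0.
  move=> z xz; rewrite (splitr (r k)); apply: ball_triangle xz.
  exact: ball_sym.
move=> [q' /= [Dq' /gI]]; rewrite !inE => /(_ Dq' Dq) -> /interior_subset qy.
have : ball (f x) e (f y).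
  apply: (@le_ball _ _ _ (r k / 2 + r k)); first by lra.
  exact: ball_triangle qx qy.
move=> /eU Uy; move/eqP: UV; apply/eqP/set0P; exists (f y); split => //.
by rewrite -inE.
Qed.

(** Two points differ iff some [E i] contains the first and not the second, so
the set where [u] and [v] differ is a countable union of measurable sets. *)
Lemma measurable_eq_on d d' (Y : measurableType d) (X : measurableType d')
    (E : nat * nat -> set X) (D : set Y) (u v : Y -> X) :
  (forall i, measurable (E i)) -> separates E -> measurable D ->
  measurable_fun D u -> measurable_fun D v ->
  measurable (D `&` [set p | u p = v p]).
Proof.
move=> mE sE mD mu mv.
rewrite (_ : _ `&` _ =
    D `\` \bigcup_i ((D `&` u @^-1` E i) `&` (D `\` (D `&` v @^-1` E i)))).
  apply: measurableD => //; apply: countable_bigcupT_measurable => [|i].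
    exact: countableP.
  apply: measurableI; first exact: mu.
  by apply: measurableD => //; exact: mv.
apply/seteqP; split => p /= [Dp].
  by move=> e; split => // -[i _ /= [[_ Eu] [_]]]; apply; rewrite -e.
move=> H; split => //; apply: contrapT => /sE [i [Eu Ev]]; apply: H.
by exists i => //; split => //; split => // -[].
Qed.

(** * Null sets in products and translates of null sets *)

(** Both iterated integrals of the indicator of [N] compute its product measure,
which is zero because the [y]-sections are null. *)
Lemma null_ysections_null_xsections (R : realType) d d'
    (X : measurableType d) (Y : measurableType d')
    (mu : {sigma_finite_measure set X -> \bar R})
    (nu : {sigma_finite_measure set Y -> \bar R}) (N : set (X * Y)) :
  measurable N -> (forall y, mu (ysection N y) = 0%E) ->
  measurable [set x | nu (xsection N x) = 0%E] /\
  mu (~` [set x | nu (xsection N x) = 0%E]) = 0%E.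
Proof.
move=> mN N0; set G := [set x | _].
have mf := measurable_fun_xsection nu mN.
have mG : measurable G.
  have -> : G = setT `&` (nu \o xsection N) @^-1` [set 0%E] by rewrite setTI.
  exact: mf.
split => //; apply: measure_negligible; first exact: measurableC.
have : (\int[mu]_x `|(nu \o xsection N) x|)%E = 0%E.
  under eq_integral do rewrite gee0_abs//.
  transitivity ((mu \x^ nu)%E N); last by apply: integral0_eq => y _; exact: N0.
  apply: product_measure_unique => // A B mA mB; exact: product_measure2E.
move/(ae_eq_integral_abs _ measurableT mf); apply: negligibleS => x /= Gx.
by move=> /(_ I).
Qed.

(** Lebesgue measure lives on [measurableTypeR R], which has the same measurable
sets as [R] under another display; [h] passes from the one to the other. *)
Lemma measurable_shift (R : realType) (t : R) :
  measurable_fun [set: measurableTypeR R] (fun u : R => u + t : measurableTypeR R).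
Proof.
have h : measurable_fun [set: measurableTypeR R] (idfun : measurableTypeR R -> R).
  by move=> ? Y mY; rewrite setTI.
exact: (measurable_realfun.measurable_funD h (measurable_cst t)).
Qed.

(** Both measures agree on the half-open intervals. *)
Lemma lebesgue_measure_shift (R : realType) (t : R) (A : set R) : measurable A ->
  pushforward lebesgue_measure (fun u : R => u + t : measurableTypeR R) A
  = lebesgue_measure A.
Proof.
move=> mA; apply/esym/lebesgue_measure_unique => //=.
  exact: measurable_shift.
move=> mf _ [[a b]] _ <-.
rewrite /pushforward (_ : _ @^-1` _ = `]a - t, b - t]%classic); last first.
  by apply/seteqP; split => x /=; rewrite !in_itv/=; lra.
rewrite !lebesgue_measure_itv/= !lte_fin ltrD2r.
by case: ifP => // _; rewrite -!EFinB; congr EFin; ring.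
Qed.

(** The translate of [Z1] by [t] is null as well, and two null sets do not cover
the line. *)
Lemma null_sets_shift_avoid (R : realType) (t : R) (Z1 Z2 : set (measurableTypeR R)) :
  measurable Z1 -> measurable Z2 ->
  lebesgue_measure Z1 = 0%E -> lebesgue_measure Z2 = 0%E ->
  exists u : R, ~ Z1 (u + t) /\ ~ Z2 u.
Proof.
move=> m1 m2 z1 z2; apply: contrapT => H.
pose Z := (fun u : R => u + t : measurableTypeR R) @^-1` Z1.
have mZ : measurable Z.
  have mf := measurable_shift t.
  by rewrite -[Z]setTI; exact: mf.
have Z0 : lebesgue_measure Z = 0%E.
  by rewrite -z1 -(lebesgue_measure_shift t m1).
have : lebesgue_measure (Z `|` Z2) = 0%E by exact: null_set_setU.
rewrite (_ : Z `|` Z2 = `]-oo, +oo[%classic) ?lebesgue_measure_itv//.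
rewrite set_itvNyy; apply/seteqP; split => // u _.
by apply: contrapT => /not_orP[? ?]; apply: H; exists u.
Qed.

(** * Transport of small sets *)

(** Absolute continuity in epsilon-delta form for [B |-> mu' (T @` B `&` A')].
If it failed for [e], there would be sets [F n] of measure below [2 ^- n.+1]
whose images have measure at least [e] inside [A'].  The upper limit of the
[F n] is null by Borel-Cantelli, hence so is its image; as [T] is injective,
that image contains the upper limit of the images, which has measure at least
[e] since [A'] has finite measure. *)
Lemma nonsingular_iso_abs_continuous (R : realType) d d'
    (X : measurableType d) (X' : measurableType d')
    (mu : {measure set X -> \bar R}) (mu' : {measure set X' -> \bar R})
    (X0 : set X) (X0' : set X') (T : X -> X') (A' : set X') :
  nonsingular_iso_on mu mu' X0 X0' T ->
  measurable A' -> (mu' A' < +oo)%E -> forall e : R, 0 < e ->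
  exists2 del : R, 0 < del & forall B, measurable B -> B `<=` X0 ->
    (mu B < del%:E)%E -> (mu' (T @` B `&` A') < e%:E)%E.
Proof.
move=> [bT mT imT nT] mA' fA' e e0; apply: contrapT => H.
have : forall n : nat, exists B, [/\ measurable B, B `<=` X0,
    (mu B < (1 / (2 ^ n.+1)%:R)%:E)%E & (e%:E <= mu' (T @` B `&` A'))%E].
  move=> n; apply: contrapT => K; apply: H; exists (1 / (2 ^ n.+1)%:R).
    by rewrite divr_gt0// ltr0n expn_gt0.
  move=> B mB BX0 muB; rewrite ltNge; apply/negP => eB.
  by apply: K; exists B.
move=> /choice[F /all_and4[mF FX0 muF eF]].
have mL : measurable (lim_sup_set F).
  by apply: bigcap_measurable => // k _; exact: bigcup_measurable.
have LX0 : lim_sup_set F `<=` X0 by move=> x /(_ 0%N I) [k _ /FX0].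
have L0 : mu (lim_sup_set F) = 0%E.
  apply: lim_sup_set_cvg0 => //.
  apply: (@le_lt_trans _ _ (\sum_(n <oo) (1 / (2 ^ n.+1)%:R)%:E)%E).
    by apply: lee_nneseries => // n _; apply: ltW; exact: muF.
  by apply: le_lt_trans (epsilon_trick0 xpredT ler01) _; rewrite ltry.
have TL0 : mu' (T @` lim_sup_set F) = 0%E by exact/nT.
pose H' n := T @` F n `&` A'.
have mH n : measurable (H' n) by apply: measurableI => //; exact: imT.
have mU n : measurable (\bigcup_(k in [set k | (n <= k)%N]) H' k).
  exact: bigcup_measurable.
have mlH : measurable (lim_sup_set H') by apply: bigcap_measurable.
have lH0 : mu' (lim_sup_set H') = 0%E.
  apply/eqP; rewrite -measure_le0 -TL0; apply: le_measure; rewrite ?inE//.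
    exact: imT.
  move=> y yH; have [k _ [[x Fx Tx] _]] := yH 0%N I.
  exists x => // n _; have [j nj [[x' Fx' Tx'] _]] := yH n I.
  exists j => //; suff <- : x' = x by [].
  apply: (set_bij_inj bT); last by rewrite Tx' Tx.
    exact/mem_set/(FX0 _ _ Fx').
  exact/mem_set/(FX0 _ _ Fx).
have := lim_sup_set_cvg mu' H' mH.
have UA : (mu' (\bigcup_(k in [set k | (0 <= k)%N]) H' k) < +oo)%E.
  apply: le_lt_trans fA'; apply: le_measure; rewrite ?inE//.
  by move=> y [k _ []].
move=> /(_ UA) c; have : (e%:E <= mu' (lim_sup_set H'))%E.
  rewrite -(cvg_lim _ c)//; apply: lime_ge; first by apply/cvg_ex; eexists; exact: c.
  apply: nearW => n; apply: le_trans (eF n) _; apply: le_measure; rewrite ?inE//.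
    exact: mH.
  by move=> y Hy; exists n => /=.
by rewrite lH0 lee_fin leNgt e0.
Qed.

Lemma mu_ext_lt_measurable_cover (R : realType) d (X : measurableType d)
    (mu : {measure set X -> \bar R}) (B : set X) (r : \bar R) :
  (mu^*%mu B < r)%E -> exists C, [/\ measurable C, B `<=` C & (mu C < r)%E].
Proof.
move=> /ereal_inf_lt[_ [F [mF BF] <-] Fr]; exists (\bigcup_k F k); split => //.
  exact: bigcup_measurable.
apply: le_lt_trans Fr; apply: measure_sigma_subadditive => //.
exact: bigcup_measurable.
Qed.

(** A set of the filter on which [f] stays below [del] serves for [g] and [e]. *)
Lemma limf_esup_eq0_transfer (R : realType) (T : choiceType) (X : filteredType T)
    (f g : X -> \bar R) (F : set (set X)) :
  ~ F set0 -> (forall x, 0 <= g x)%E ->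
  (forall e : R, 0 < e -> exists2 del : R, 0 < del &
    forall x, (f x < del%:E)%E -> (g x < e%:E)%E) ->
  limf_esup f F = 0%E -> limf_esup g F = 0%E.
Proof.
move=> F0 g0 fg f0; apply/eqP; rewrite eq_le limf_esup_ge0// andbT.
apply/lee_addgt0Pr => e /fg[del del0 fge]; rewrite add0e.
have : (limf_esup f F < del%:E)%E by rewrite f0 lte_fin.
move=> /ereal_inf_lt[_ [V FV <-] supV].
apply: ge_ereal_inf; exists (ereal_sup (g @` V)); first by exists V.
apply: ge_ereal_sup => _ [x Vx <-]; apply/ltW/fge; apply: le_lt_trans supV.
by apply: ereal_sup_ubound; exists x.
Qed.

(** * Flows and conjugacies *)

Lemma flowK (R : realType) d (X : measurableType d) (mu : set X -> \bar R)
    (F : R -> X -> X) (t : R) : flow mu F -> cancel (F t) (F (- t)).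
Proof. by move=> [_ F0 FD _] x; rewrite -FD addNr F0. Qed.

Lemma flow_preimage_null (R : realType) d (X : measurableType d)
    (mu : {measure set X -> \bar R}) (F : R -> X -> X) (t : R) (N : set X) :
  flow mu F -> measurable N -> mu N = 0%E ->
  measurable (F t @^-1` N) /\ mu (F t @^-1` N) = 0%E.
Proof.
move=> hF mN N0; have [nF _ _ _] := hF.
have -> : F t @^-1` N = F (- t) @` N.
  apply/seteqP; split=> [x Nx|_ [x Nx <-] /=].
    by exists (F t x) => //; exact: (flowK t hF).
  by have := flowK (- t) hF x; rewrite opprK => ->.
have [_ _ im n0] := nF (- t).
have NT : N `<=` setT by [].
by split; [exact: im|exact/(n0 _ NT)].
Qed.

(** Joint measurability of a flow, with time carried by the measurable type on
which Lebesgue measure is defined, so that Tonelli applies. *)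
Lemma flow_measurableTypeR (R : realType) d (X : measurableType d)
    (mu : set X -> \bar R) (F : R -> X -> X) : flow mu F ->
  measurable_fun [set: X * measurableTypeR R] (fun p => F p.2 p.1).
Proof.
move=> [_ _ _ mF].
have mi : measurable_fun [set: X * measurableTypeR R]
    (fun p => (p.1, p.2) : X * R).
  apply: measurable_fun_pair; first exact: measurable_fst.
  exact: (@measurable_snd _ _ X (measurableTypeR R)).
exact: (measurableT_comp mF mi).
Qed.

(** The almost everywhere relation at each fixed time is made uniform in time:
on a conull set [G], [T] reflects the orbit relation together with the times.
[G] consists of the points whose orbit satisfies the conjugacy equation, within
[X0], at Lebesgue-almost every time. *)
Lemma conull_orbit_conjugacy (R : realType) d d'
    (X : measurableType d) (X' : measurableType d')
    (mu : {sigma_finite_measure set X -> \bar R}) (mu' : set X' -> \bar R)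
    (F : R -> X -> X) (F' : R -> X' -> X') (X0 : set X) (T : X -> X') :
  standard_borel R X' -> flow mu F -> flow mu' F' ->
  measurable X0 -> mu (~` X0) = 0%E ->
  measurable_fun X0 T -> {in X0 &, injective T} ->
  (forall t, {ae mu, forall x, F' t (T x) = T (F t x)}) ->
  exists G : set X, [/\ measurable G, mu (~` G) = 0%E, G `<=` X0 &
    forall x y t, G x -> G y -> F' t (T x) = T y -> F t x = y].
Proof.
move=> /standard_borel_separates[Es [mEs sEs]] hF hF' mX0 X00 mT iT aeT.
pose S := (X * measurableTypeR R)%type.
(* [T] is only measurable on [X0]; its restriction [T1], constant elsewhere, is
   measurable on the whole space. *)
pose T1 := T \_ X0.
have mT1 : measurable_fun setT T1 by exact/(measurable_restrictT T mX0).
have T1E x : X0 x -> T1 x = T x by move=> Xx; rewrite /T1 patchE mem_set.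
have mF := flow_measurableTypeR hF.
have mF' := flow_measurableTypeR hF'.
pose u (p : S) := F' p.2 (T1 p.1).
pose v (p : S) := T1 (F p.2 p.1).
have mu_ : measurable_fun setT u.
  apply: (@measurableT_comp _ _ _ _ _ _
    (fun q : X' * measurableTypeR R => F' q.2 q.1) setT
    (fun p : S => (T1 p.1, p.2))) => //.
  apply: measurable_fun_pair; last exact: measurable_snd.
  by apply: measurableT_comp => //; exact: measurable_fst.
have mv : measurable_fun setT v by exact: measurableT_comp.
pose Dm : set S := (fst @^-1` X0) `&` ((fun p => F p.2 p.1) @^-1` X0).
have mDm : measurable Dm.
  apply: measurableI; rewrite -[X in measurable X]setTI.
    exact: measurable_fst.
  exact: mF.
(* Pairs outside [Dm] are bad too: where [T1] is not [T], the equation [u = v]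
   says nothing. *)
pose N := ~` (Dm `&` [set p | u p = v p]).
have mN : measurable N.
  apply: measurableC; apply: (measurable_eq_on mEs sEs) => //.
    exact: measurable_funTS.
  exact: measurable_funTS.
have N0 (t : measurableTypeR R) : mu (ysection N t) = 0%E.
  apply: measure_negligible; first exact: measurable_ysection.
  have [mX1 X10] := flow_preimage_null t hF (measurableC mX0) X00.
  have n0 : mu.-negligible (~` X0) by exists (~` X0); split => //; exact: measurableC.
  have n1 : mu.-negligible (F t @^-1` (~` X0)) by exists (F t @^-1` (~` X0)); split.
  apply: negligibleS (negligibleU (negligibleU n0 n1) (aeT t)).
  move=> x /=; rewrite /ysection /= inE => H.
  apply: contrapT => /not_orP[/not_orP[/contrapT x0 /contrapT x1] /contrapT e].
  by apply: H; split; [split|rewrite /u /v /= !T1E].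
have [mG G0] := null_ysections_null_xsections (@lebesgue_measure R) mN N0.
set G := [set x | _] in mG G0.
have GE x : G x -> measurable (xsection N x : set (measurableTypeR R)) /\
    lebesgue_measure (xsection N x) = 0%E.
  by move=> Gx; split => //; exact: measurable_xsection.
have NE x t : ~ xsection N x t ->
    [/\ X0 x, X0 (F t x) & F' t (T x) = T (F t x)].
  rewrite /xsection /= inE => /contrapT[[/= a b]].
  by rewrite /u /v /= !T1E.
exists G; split => //.
  (* A good point has at least one time at which its pair is not bad. *)
  move=> x /GE[mx x0].
  by have [w [_ /NE[]]] := null_sets_shift_avoid 0 mx mx x0 x0.
move=> x y t /GE[mx x0] /GE[my y0] Txy.
have [w [/NE[_ X1 e1] /NE[_ X2 e2]]] := null_sets_shift_avoid t mx my x0 y0.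
have [_ _ FD _] := hF; have [_ _ FD' _] := hF'.
apply: (can_inj (flowK w hF)); rewrite -FD.
by apply: iT; rewrite ?inE//; rewrite -e1 FD' Txy.
Qed.

Theorem proposition3p3 (R : realType) (d d' : measure_display)
    (X : measurableType d) (X' : measurableType d')
    (mu : {sigma_finite_measure set X -> \bar R})
    (mu' : {sigma_finite_measure set X' -> \bar R})
    (F : R -> X -> X) (F' : R -> X' -> X')
    (hX : standard_borel R X) (hX' : standard_borel R X')
    (hF : flow mu F) (hF' : flow mu' F')
    (hFF' : conjugate_flows mu mu' F F') :
  property_B mu F -> property_B mu' F'.
Proof.
move=> [A [mA A0 BA]].
have [T [[X0 [X0' [[mX0 X00] _ isoT]]] aeT]] := hFF'.
have [bT mT imT nT] := isoT.
have [G [mG G0 GX0 GT]] :=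
  conull_orbit_conjugacy hX' hF hF' mX0 X00 mT (set_bij_inj bT) aeT.
pose A1 := A `&` G.
have mA1 : measurable A1 by exact: measurableI.
have A1X0 : A1 `<=` X0 by move=> x [_ /GX0].
have mTA1 : measurable (T @` A1) by exact: imT.
have TA1 : mu' (T @` A1) != 0%E.
  apply/eqP => /(nT _ A1X0 mA1) muA1.
  suff muA : mu A = 0%E by have : (0 < mu A)%E := A0; rewrite muA ltxx.
  apply: measure_negligible => //.
  have n1 : mu.-negligible A1 by exists A1; split.
  have n2 : mu.-negligible (~` G) by exists (~` G); split => //; exact: measurableC.
  apply: negligibleS (negligibleU n1 n2) => x Ax.
  by have [Gx|nGx] := pselect (G x); [left|right].
(* The image of the good part of [A] is cut down to finite measure, as absolute
   continuity in epsilon-delta form requires. *)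
have [K KT Kfin] := sigma_finiteT mu'.
have [n Kn] : exists n, mu' (T @` A1 `&` K n) != 0%E.
  apply: contrapT => /forallNP H; move/negP : TA1; apply; apply/eqP.
  apply: measure_negligible => //.
  have : mu'.-negligible (\bigcup_n (T @` A1 `&` K n)).
    apply: negligible_bigcup => n; exists (T @` A1 `&` K n); split => //.
      by apply: measurableI => //; have [] := Kfin n.
    by apply/eqP/negPn/negP; exact: H.
  by apply: negligibleS; rewrite -setI_bigcupr -KT setIT.
have [mK fK] := Kfin n.
pose A' := T @` A1 `&` K n.
have mA' : measurable A' by exact: measurableI.
have fA' : (mu' A' < +oo)%E.
  by apply: le_lt_trans fK; apply: le_measure; rewrite ?inE//; exact: subIsetr.
exists A'; split => //; first by rewrite lt0e Kn measure_ge0.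
move=> del del0; apply: limf_esup_eq0_transfer (BA _ del0).
- exact: filter_not_empty.
- by move=> s; apply: mu_ext_ge0.
move=> e e0.
(* The part in [X0] of a measurable cover [C] of the return set of [A] has an
   image that covers the return set of [A']. *)
have [eta eta0 He] := nonsingular_iso_abs_continuous isoT mA' fA' e0.
exists eta => // s /mu_ext_lt_measurable_cover[C [mC sC muC]].
have CX0 : C `&` X0 `<=` X0 by exact: subIsetr.
have mCX : measurable (C `&` X0) by exact: measurableI.
have mTC : measurable (T @` (C `&` X0) `&` A').
  by apply: measurableI => //; exact: imT.
apply: le_lt_trans (He _ mCX CX0 _); last first.
  by apply: le_lt_trans muC; apply: le_measure; rewrite ?inE//; exact: subIsetl.
rewrite -(measurable_mu_extE mu' mTC).
apply: le_mu_ext => _ [[[x [Ax Gx] <-] Kx] [t [It [[y [Ay Gy] Txy] _]]]].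
split; last by split => //; exists x.
exists x => //; split; last exact: GX0.
apply: sC; split => //; exists t; split => //.
by rewrite (GT _ _ _ Gx Gy (esym Txy)).
Qed.
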